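(* Let $G=(V_E\,\dot\cup\,V_V,E)$ be a finite bipartite graph in which every edge joins a node of $V_E$ to a node of $V_V$, let $\mathcal{M}\subseteq E$ be a matching in $G$, let $F_j\in V_E$ be exposed with respect to $\mathcal{M}$, and let $H=(V_H,E_H)$ be the connection graph for $F_j$ with respect to $\mathcal{M}$. Let $M\ge 1$ and let $(F_{i_1},v_{k_1},F_{\ell_1}),\dots,(F_{i_M},v_{k_M},F_{\ell_M})\in V_E\times V_V\times V_E$ be pairwise distinct triples such that $\{v_{k_m},F_{\ell_m}\}\in\mathcal{M}$ for every $m=1,\dots,M$. Then the following statements are equivalent: 1. The set $\mathcal{C}:=\{(F_{i_1},v_{k_1},F_{\ell_1}),\dots,(F_{i_M},v_{k_M},F_{\ell_M})\}$ is a connection for $F_j$ with respect to $\mathcal{M}$. 2. The directed graph $\mathcal{H}:=(V_H,\{(F_{i_1},F_{\ell_1}),\dots,(F_{i_M},F_{\ell_M})\})$ is a subgraph of $H$ and is an arborescence with root $F_j$.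
   Context: Throughout, $G=(V_E\,\dot\cup\,V_V,E)$ is a finite bipartite graph with ''equation nodes'' $V_E$ (denoted $F_i$) and ''variable nodes'' $V_V$ (denoted $v_k$), with edges only between $V_E$ and $V_V$. A matching $\mathcal{M}\subseteq E$ is a set of edges no two of which share a node. A node $F_j\in V_E$ is exposed with respect to $\mathcal{M}$ if it is not incident to any edge of $\mathcal{M}$. Alternating path (with respect to $\mathcal{M}$) between $F_{i_1}$ and $F_{i_N}$, $N\ge 2$: a sequence of edges $(\{F_{i_1},v_{k_1}\},\{v_{k_1},F_{i_2}\},\{F_{i_2},v_{k_2}\},\dots,\{v_{k_{N-1}},F_{i_N}\})$ of $G$, with $F_{i_1},\dots,F_{i_N}$ pairwise distinct and $v_{k_1},\dots,v_{k_{N-1}}$ pairwise distinct, that alternates between non-matching and matching edges and starts with a non-matching edge; i.e. $\{F_{i_m},v_{k_m}\}\in E\setminus\mathcal{M}$ and $\{v_{k_m},F_{i_{m+1}}\}\in\mathcal{M}$ for all $m$. A triple $(F_i,v_k,F_\ell)\in V_E\times V_V\times V_E$ with $\{F_i,v_k\}\in E\setminus\mathcal{M}$ and $\{v_k,F_\ell\}\in\mathcal{M}$ is identified with the alternating path (of two edges) $(\{F_i,v_k\},\{v_k,F_\ell\})$, said to start in $F_i$. For exposed $F_j$, set $C_{F_j}:=\{F_k\in V_E \mid \text{there is an alternating path between } F_j \text{ and } F_k \text{ in } G\}$. Connection for $F_j$ with respect to $\mathcal{M}$: a set $\mathcal{C}$ of triples $(F_i,v_k,F_\ell)\in V_E\times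 V_V\times V_E$ with $\{F_i,v_k\}\in E\setminus\mathcal{M}$ and $\{v_k,F_\ell\}\in\mathcal{M}$ such that (a) the alternating paths in $\mathcal{C}$ are connected, i.e. the subgraph of $G$ formed by all edges $\{F_i,v_k\},\{v_k,F_\ell\}$ of triples in $\mathcal{C}$ (and their endpoints) is connected; (b) for every $F_\ell\in C_{F_j}$ the corresponding matching edge $\{v_k,F_\ell\}\in\mathcal{M}$ occurs in exactly one triple of $\mathcal{C}$; (c) at least one triple of $\mathcal{C}$ starts in $F_j$. Connection graph for $F_j$ with respect to $\mathcal{M}$: the directed graph $H=(V_H,E_H)$ with $V_H:=C_{F_j}\,\dot\cup\,\{F_j\}$ and $E_H:=\{(F_i,F_\ell)\in V_H\times V_H \mid \exists\, v_k\in V_V:\ \{F_i,v_k\}\in E\setminus\mathcal{M},\ \{v_k,F_\ell\}\in\mathcal{M}\}$. Arborescence: the underlying undirected graph of a directed graph is obtained by replacing every directed edge by an undirected edge (a pair of opposite directed edges gives two parallel edges, which count as a cycle). A directed graph is a branching if its underlying undirected graph is a forest (has no cycles) and every node has at most one edge ending in it. An arborescence is a branching whose underlying undirected graph is connected; its root is the unique node in which no edge ends. *)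

(* Defs.v *)
From mathcomp Require Import all_boot.
From mathcomp Require Import boolp.

Set Implicit Arguments.
Unset Strict Implicit.
Unset Printing Implicit Defensive.

(* A bipartite graph on equation nodes VE and variable nodes VV is given by
   its edge set E : {set VE * VV}; (F, v) stands for the undirected edge
   {F, v}.  A triple (F_i, v_k, F_l) is an element of VE * VV * VE. *)

Definition matching (VE VV : finType) (E M : {set VE * VV}) : Prop :=
  M \subset E /\
  {in M &, forall e f, e != f -> e.1 != f.1 /\ e.2 != f.2}.

Definition exposed (VE VV : finType) (M : {set VE * VV}) (F : VE) : Prop :=
  forall v, (F, v) \notin M.

(* The path visits F 0, v 0, F 1, v 1, ..., v n, F n.+1, so that the number of
   equation nodes on it is N = n.+2. *)
Definition alternating_path (VE VV : finType) (E M : {set VE * VV})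
    (Fi Fl : VE) : Prop :=
  exists (n : nat) (F : 'I_n.+2 -> VE) (v : 'I_n.+1 -> VV),
    [/\ injective F, injective v, F ord0 = Fi, F ord_max = Fl
      & forall m : 'I_n.+1,
          (F (widen_ord (leqnSn n.+1) m), v m) \in E :\: M /\
          (F (lift ord0 m), v m) \in M].

Definition reach_set (VE VV : finType) (E M : {set VE * VV}) (Fj : VE) :
    {set VE} :=
  [set F | `[< alternating_path E M Fj F >]].

(* Any two nodes of A are joined by a walk in e; only used for symmetric
   relations e whose edges have both ends in A. *)
Definition connected_on (T : finType) (A : {set T}) (e : rel T) : Prop :=
  {in A &, forall x y, connect e x y}.

Definition alternating_triple (VE VV : finType) (E M : {set VE * VV})
    (t : VE * VV * VE) : Prop :=
  let: (Fi, v, Fl) := t in (Fi, v) \in E :\: M /\ (Fl, v) \in M.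

Definition triple_edges (VE VV : finType) (t : VE * VV * VE) :
    {set VE * VV} :=
  let: (Fi, v, Fl) := t in [set (Fi, v); (Fl, v)].

Definition edge_adj (VE VV : finType) (S : {set VE * VV}) : rel (VE + VV) :=
  fun x y => match x, y with
             | inl F, inr v | inr v, inl F => (F, v) \in S
             | _, _ => false
             end.

Definition edge_nodes (VE VV : finType) (S : {set VE * VV}) :
    {set VE + VV} :=
  [set x | [exists y, edge_adj S x y]].

Definition connection (VE VV : finType) (E M : {set VE * VV}) (Fj : VE)
    (C : {set VE * VV * VE}) : Prop :=
  let S := \bigcup_(t in C) triple_edges t in
  [/\ forall t, t \in C -> alternating_triple E M t,
      connected_on (edge_nodes S) (edge_adj S),
      forall F v, F \in reach_set E M Fj -> (F, v) \in M ->
        #|[set t in C | (F, v) \in triple_edges t]| = 1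
    & exists2 t, t \in C & t.1.1 = Fj].

Record digraph (V : finType) := Digraph {
  nodes : {set V};
  arcs : {set V * V}
}.

Definition wf_digraph (V : finType) (D : digraph V) : Prop :=
  arcs D \subset setX (nodes D) (nodes D).

Definition subdigraph (V : finType) (D D' : digraph V) : Prop :=
  [/\ wf_digraph D, nodes D \subset nodes D' & arcs D \subset arcs D'].

(* The underlying undirected graph of D is a multigraph: each arc a is an edge
   with ends a.1 and a.2, and opposite arcs are parallel edges. *)
Definition joins (V : finType) (a : V * V) (x y : V) : bool :=
  (a == (x, y)) || (a == (y, x)).

Definition underlying_adj (V : finType) (D : digraph V) : rel V :=
  fun x y => [exists a in arcs D, joins a x y].

(* A cycle x 0, e 0, x 1, ..., x n, e n, x 0 with distinct nodes and distinct
   edges.  Length 1 is a loop and length 2 a pair of parallel edges. *)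
Definition underlying_cycle (V : finType) (D : digraph V) : Prop :=
  exists (n : nat) (x : 'I_n.+1 -> V) (e : 'I_n.+1 -> V * V),
    [/\ injective x, injective e
      & forall i, e i \in arcs D /\ joins (e i) (x i) (x (ordS i))].

Definition arcs_into (V : finType) (D : digraph V) (x : V) : {set V * V} :=
  [set a in arcs D | a.2 == x].

Definition branching (V : finType) (D : digraph V) : Prop :=
  [/\ wf_digraph D, ~ underlying_cycle D
    & forall x, x \in nodes D -> #|arcs_into D x| <= 1].

Definition arborescence (V : finType) (D : digraph V) : Prop :=
  branching D /\ connected_on (nodes D) (underlying_adj D).

Definition arborescence_with_root (V : finType) (D : digraph V) (r : V) :
    Prop :=
  arborescence D /\ [set x in nodes D | arcs_into D x == set0] = [set r].

Definition connection_graph (VE VV : finType) (E M : {set VE * VV})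
    (Fj : VE) : digraph VE :=
  let VH := Fj |: reach_set E M Fj in
  Digraph VH
    [set a in setX VH VH |
      [exists v, ((a.1, v) \in E :\: M) && ((a.2, v) \in M)]].

(* Main.v *)
Require Import Defs.
From mathcomp Require Import all_boot.
From mathcomp Require Import boolp.

Set Implicit Arguments.
Unset Strict Implicit.
Unset Printing Implicit Defensive.

(** For the forward direction, let [W] be the set of equation nodes reachable
    from [Fj] along the arcs of the triples.  Every element of [W] other than
    [Fj] is the end of exactly one triple, and that triple starts in [W]; hence
    [W] is a union of components of the graph spanned by the triples, which is
    connected, so [W] is everything.  A cycle in the underlying graph would
    contain the only arc into each of its nodes, so that it could not be reached
    from [Fj].  For the converse, the matching determines the variable node of a
    triple from its last equation node. *)

Lemma connect_last_step (T : finType) (e : rel T) (x y : T) :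
  connect e x y -> x != y -> exists2 z, connect e x z & e z y.
Proof.
case/connectP=> p; case/lastP: p => [_ -> /eqP //|p z].
rewrite rcons_path last_rcons => /andP[px ez] -> _.
by exists (last x p) => //; apply/connectP; exists p.
Qed.

Lemma joins_fst (V : finType) (a : V * V) (x y : V) :
  joins a x y -> a.1 \in [:: x; y].
Proof. by case/orP=> /eqP->; rewrite !inE eqxx ?orbT. Qed.

Lemma joins_snd (V : finType) (a : V * V) (x y : V) :
  joins a x y -> a.2 \in [:: x; y].
Proof. by case/orP=> /eqP->; rewrite !inE eqxx ?orbT. Qed.

Lemma underlying_adj_sym (V : finType) (D : digraph V) :
  symmetric (underlying_adj D).
Proof.
by move=> x y; apply: eq_existsb => a; rewrite /joins [(a == (x, y)) || _]orbC.
Qed.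

Lemma mem_triple_edges_end (VE VV : finType) (t : VE * VV * VE) :
  (t.2, t.1.2) \in triple_edges t.
Proof. by case: t => [[a v] b]; rewrite !inE eqxx orbT. Qed.

(** * Digraphs in which every node is reached from a source *)

Section RootedDigraph.
Variables (V : finType) (D : digraph V) (r : V).
Let arc : rel V := fun x y => (x, y) \in arcs D.
Hypothesis indeg_le1 : forall x, #|arcs_into D x| <= 1.
Hypothesis root_source : arcs_into D r = set0.

Lemma arc_head_inj : {in arcs D &, injective snd}.
Proof.
move=> a b aD bD /= ab.
by apply: (card_le1_eqP (indeg_le1 b.2)); rewrite inE ?aD ?bD ?ab /=.
Qed.

Lemma root_no_arc x : (x, r) \notin arcs D.
Proof.
apply/negP=> xr; have : (x, r) \in arcs_into D r by rewrite inE xr /=.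
by rewrite root_source inE.
Qed.

(** The edges of a cycle have distinct heads, so every node of the cycle is the head of a cycle
    edge, which is then the only arc into it. Tracing a walk from [r] backwards thus never leaves
    the cycle, and puts the source [r] at the head of an arc. *)
Lemma rooted_acyclic :
  (forall a, a \in arcs D -> connect arc r a.2) -> ~ underlying_cycle D.
Proof.
move=> reach [n [x [e [xI eI cyc]]]].
pose h i := (e i).2.
have hI : injective h.
  by move=> i j hij; apply: eI; exact: arc_head_inj (cyc i).1 (cyc j).1 hij.
have hx i : h i \in codom x.
  have [_ /joins_snd] := cyc i.
  by rewrite !inE => /orP[]/eqP E; rewrite /h E codom_f.
have ex i : (e i).1 \in codom x.
  have [_ /joins_fst] := cyc i.
  by rewrite !inE => /orP[]/eqP ->; rewrite codom_f.
(* There are as many edges as nodes on the cycle, so the injective choice of heads hits all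
   nodes. *)
have hsurj : codom h =i codom x.
  apply/subset_cardP; first by rewrite !card_codom.
  by apply/subsetP=> _ /codomP[i ->].
have pred_closed a b : arc a b -> b \in codom x -> a \in codom x.
  move=> ab; rewrite -hsurj => /codomP[k bk].
  by rewrite (_ : a = (e k).1) // -(@arc_head_inj (a, b) (e k)) //; case: (cyc k).
have back a b : connect arc a b -> b \in codom x -> a \in codom x.
  case/connectP=> p; elim: p a => [|c p IH] a /= => [_ -> //|].
  by case/andP=> ac pc lb bx; apply: pred_closed ac _; exact: IH.
have [e0 _] := cyc ord0.
have := back _ _ (reach _ e0) (hx ord0); rewrite -hsurj => /codomP[k rk].
have [ek _] := cyc k; have := root_no_arc (e k).1.
by rewrite rk /h -surjective_pairing ek.
Qed.

(** Two nodes are joined through [r] in the underlying graph, and a node other than [r] is entered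
    by the last arc of a walk from [r]. *)
Lemma rooted_arborescence :
  wf_digraph D -> r \in nodes D ->
  {in nodes D, forall x, connect arc r x} -> arborescence_with_root D r.
Proof.
move=> wf rD reach; split; first split; first split=> //.
- apply: rooted_acyclic => -[a b] /(subsetP wf).
  by rewrite inE => /andP[_ bD]; exact: reach.
- have sub a b : connect arc a b -> connect (underlying_adj D) a b.
    apply: connect_sub => c d cd; apply: connect1; apply/existsP.
    by exists (c, d); rewrite /joins eqxx andbT.
  move=> x y xD yD; apply: (@connect_trans _ _ r); last exact/sub/reach.
  by rewrite (sym_connect_sym (underlying_adj_sym D)); exact/sub/reach.
- apply/setP=> x; rewrite !inE; apply/andP/eqP => [[xD /eqP x0]|->].
    apply/eqP/negPn/negP => xr.
    have [|z _ zx] := connect_last_step (reach x xD); first by rewrite eq_sym.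
    suff : (z, x) \in arcs_into D x by rewrite x0 inE.
    by rewrite inE [_ \in _]zx /=.
  by rewrite rD root_source.
Qed.

End RootedDigraph.

(** * Matchings, and alternating paths viewed as walks *)

Section Matching.
Variables (VE VV : finType) (E M : {set VE * VV}).
Hypothesis ME : matching E M.

Lemma matching_var F v w : (F, v) \in M -> (F, w) \in M -> v = w.
Proof.
move=> Fv Fw; apply: contrapT => /eqP vw.
have [|/eqP //] := ME.2 _ _ Fv Fw.
by apply: contra_neq vw => -[].
Qed.

Lemma matching_eqn F G v : (F, v) \in M -> (G, v) \in M -> F = G.
Proof.
move=> Fv Gv; apply: contrapT => /eqP FG.
have [|_ /eqP //] := ME.2 _ _ Fv Gv.
by apply: contra_neq FG => -[].
Qed.

(** The arcs of the connection graph, before restriction to its node set. *)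
Definition alternating_step : rel VE :=
  fun x y => [exists v, ((x, v) \in E :\: M) && ((y, v) \in M)].

Lemma alternating_path_connect x y :
  alternating_path E M x y -> connect alternating_step x y.
Proof.
case=> n [F [v [_ _ <- <- step]]].
suff H k (kn : k < n.+2) : connect alternating_step (F ord0) (F (Ordinal kn)).
  by rewrite (_ : ord_max = Ordinal (ltnSn n.+1)) //; apply: val_inj.
elim: k kn => [|k IH] kn; first by rewrite (_ : Ordinal kn = ord0) //; apply: val_inj.
apply: connect_trans (IH (ltnW kn)) (connect1 _).
have [s1 s2] := step (Ordinal (kn : k < n.+1)).
apply/existsP; exists (v (Ordinal (kn : k < n.+1))); apply/andP; split.
  by rewrite (_ : Ordinal _ = widen_ord (leqnSn n.+1) (Ordinal (kn : k < n.+1))) //;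
    apply: val_inj.
by rewrite (_ : Ordinal kn = lift ord0 (Ordinal (kn : k < n.+1))) //; apply: val_inj.
Qed.

(** Shortening the walk makes its equation nodes distinct. The variable nodes are then distinct as
    well, since each is matched to the equation node that follows it. *)
Lemma connect_alternating_path x y :
  connect alternating_step x y -> x != y -> alternating_path E M x y.
Proof.
case/connectP=> p0 /shortenP[p px up _] -> {p0 y}.
case: p px up => [_ _ /eqP //|z p] px up _.
pose F (i : 'I_(size p).+2) := nth x [:: x, z & p] i.
have FI : injective F.
  by move=> i j /eqP; rewrite nth_uniq ?ltn_ord // => /eqP/val_inj.
have step (m : 'I_(size p).+1) : exists v,
    (F (widen_ord (leqnSn _) m), v) \in E :\: M /\ (F (lift ord0 m), v) \in M.
  have /existsP[v /andP[v1 v2]] := pathP x px m (ltn_ord m).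
  by exists v.
have [v vP] := fin_all_exists step.
exists (size p), F, v; split=> //.
- move=> i j vij; apply: (@lift_inj _ ord0); apply: FI.
  by apply: (@matching_eqn _ _ (v i)); [case: (vP i)|rewrite vij; case: (vP j)].
- by rewrite /F (last_nth x) /=.
Qed.

Lemma connection_nodes Fj :
  nodes (connection_graph E M Fj) = [set F | connect alternating_step Fj F].
Proof.
apply/setP=> F; rewrite !inE; have [->|FF] := eqVneq F Fj; first by rewrite connect0.
apply/asboolP/idP => [/alternating_path_connect //|].
by move/connect_alternating_path; apply; rewrite eq_sym.
Qed.

(** * The digraph and the bipartite subgraph spanned by a set of triples *)

Section Triples.
Variables (Fj : VE) (C : {set VE * VV * VE}).
Hypothesis Fj_exposed : exposed M Fj.
Hypothesis C_matched : forall t, t \in C -> (t.2, t.1.2) \in M.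

Definition triple_digraph : digraph VE :=
  Digraph (nodes (connection_graph E M Fj)) [set (t.1.1, t.2) | t in C].

Let S := \bigcup_(t in C) triple_edges t.
Let D := triple_digraph.
Let arc : rel VE := fun x y => (x, y) \in arcs D.

Lemma triple_edgesP F v :
  reflect (exists2 t, t \in C & v = t.1.2 /\ (F = t.1.1 \/ F = t.2))
    ((F, v) \in S).
Proof.
apply: (iffP bigcupP) => -[[[a w] b] tC].
  by rewrite !inE => /orP[]/eqP[-> ->]; exists (a, w, b) => //=; auto.
by case=> /= -> [] ->; exists (a, w, b); rewrite // !inE eqxx ?orbT.
Qed.

Lemma triple_end_neq_exposed t : t \in C -> t.2 != Fj.
Proof.
move=> tC; apply: contraTneq (C_matched tC) => ->.
exact: Fj_exposed.
Qed.

Lemma edge_adj_sym : symmetric (edge_adj S).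
Proof. by move=> [a|a] [b|b]. Qed.

Lemma triple_edges_start t : t \in C -> (t.1.1, t.1.2) \in S.
Proof. by move=> tC; apply/triple_edgesP; exists t; auto. Qed.

Lemma triple_edges_end t : t \in C -> (t.2, t.1.2) \in S.
Proof. by move=> tC; apply/triple_edgesP; exists t; auto. Qed.

Lemma edge_nodes_start t : t \in C -> inl t.1.1 \in edge_nodes S.
Proof.
by move=> tC; rewrite inE; apply/existsP; exists (inr t.1.2);
  exact: triple_edges_start.
Qed.

Lemma edge_nodes_end t : t \in C -> inl t.2 \in edge_nodes S.
Proof.
by move=> tC; rewrite inE; apply/existsP; exists (inr t.1.2);
  exact: triple_edges_end.
Qed.

(** The first edge of an alternating triple lies outside [M], so its only matching edge is the one
    at its end. *)
Lemma matched_triple_edge t F v :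
  alternating_triple E M t -> (F, v) \in M -> (F, v) \in triple_edges t ->
  t.2 = F /\ t.1.2 = v.
Proof.
case: t => [[a w] b] /= [aw _] Fv; rewrite !inE => /orP[]/eqP[Fa vw]; last by [].
by move: aw; rewrite inE -Fa -vw Fv.
Qed.

Lemma arc_in_arcs t : t \in C -> arc t.1.1 t.2.
Proof. by move=> tC; apply/imsetP; exists t. Qed.

Lemma reach_matched F :
  F \in reach_set E M Fj -> exists v, (F, v) \in M.
Proof.
rewrite inE => /asboolP[n [G [v [_ _ _ <- step]]]].
have [_ vM] := step ord_max; exists (v ord_max).
by rewrite (_ : ord_max = lift ord0 (ord_max : 'I_n.+1)) //; apply: val_inj.
Qed.

(** * From a connection to an arborescence *)

Section Connection.
Hypothesis CC : connection E M Fj C.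

Lemma connection_alternating t : t \in C -> alternating_triple E M t.
Proof. by case: CC => alt _ _ _; exact: alt. Qed.

Lemma arc_alternating_step x y : arc x y -> alternating_step x y.
Proof.
case/imsetP=> -[[a w] b] /connection_alternating/= [aw bw] [-> ->].
by apply/existsP; exists w; rewrite aw bw.
Qed.

Lemma connect_arc_nodes F : connect arc Fj F -> F \in nodes D.
Proof.
rewrite [nodes _]connection_nodes inE; apply: connect_sub => x y.
by move/arc_alternating_step/connect1.
Qed.

Lemma node_reach F : F \in nodes D -> F != Fj -> F \in reach_set E M Fj.
Proof. by rewrite !inE => /orP[/eqP->|//]; rewrite eqxx. Qed.

(** A common end forces a common variable, so both triples contain the same matching edge, which
    occurs in exactly one triple of [C]. *)
Lemma reach_triple_unique t u :
  t \in C -> u \in C -> t.2 = u.2 -> t.2 \in reach_set E M Fj -> t = u.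
Proof.
move=> tC uC tu tR; have [_ _ uniq _] := CC.
have tM := C_matched tC; have uM := C_matched uC.
have vE : t.1.2 = u.1.2 by apply: matching_var tM _; rewrite tu.
have /eq_leq/card_le1_eqP := uniq _ _ tR tM.
by apply; rewrite inE ?tC ?uC ?mem_triple_edges_end // tu vE mem_triple_edges_end.
Qed.

(** From right to left, the last arc of a walk from [Fj] to [t.2] comes from a triple with that end,
    hence from [t] itself, so the walk passes through [t.1.1]. *)
Lemma connect_arc_triple t :
  t \in C -> connect arc Fj t.1.1 = connect arc Fj t.2.
Proof.
move=> tC; apply/idP/idP => [c|c].
  exact: connect_trans c (connect1 (arc_in_arcs tC)).
have tFj := triple_end_neq_exposed tC.
have [|z cz /imsetP[u uC [zu tu]]] := connect_last_step c; first by rewrite eq_sym.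
rewrite (@reach_triple_unique t u) -?zu //.
exact: node_reach (connect_arc_nodes c) tFj.
Qed.

(** Being reached from [Fj] is invariant along the edges of the triples; connectedness carries it
    from the triple [t0] starting in [Fj] to all others. *)
Lemma connection_reaches t : t \in C -> connect arc Fj t.2.
Proof.
move=> tC; have [_ conn _ [t0 t0C t0F]] := CC.
(* A variable node counts as reached when its matching partner is. *)
pose P (x : VE + VV) := match x with
  | inl F => connect arc Fj F
  | inr v => [exists F, connect arc Fj F && ((F, v) \in M)]
  end.
have Pvar u : u \in C -> P (inr u.1.2) = connect arc Fj u.2.
  move=> uC; have uM := C_matched uC.
  apply/existsP/idP => [[F /andP[cF FM]]|c]; last by exists u.2; rewrite c uM.
  by rewrite -(@matching_eqn F u.2 u.1.2).
have Pedge F v : (F, v) \in S -> P (inl F) = P (inr v).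
  case/triple_edgesP=> u uC [-> FE]; rewrite Pvar //.
  by case: FE => -> //=; exact: connect_arc_triple.
have Pclosed : closed (edge_adj S) P.
  by move=> [a|a] [b|b] //= ab; [|symmetry]; exact: Pedge.
have := closed_connect Pclosed
  (conn _ _ (edge_nodes_start t0C) (edge_nodes_end tC)).
by rewrite !unfold_in /= t0F connect0 => <-.
Qed.

Lemma connection_nodes_reached : {in nodes D, forall F, connect arc Fj F}.
Proof.
move=> F FD; have [->|FFj] := eqVneq F Fj; first exact: connect0.
have FR := node_reach FD FFj; have [v Fv] := reach_matched FR.
have [_ _ uniq _] := CC.
have /eqP/cards1P[t tE] := uniq _ _ FR Fv.
have : t \in [set t] by rewrite inE.
rewrite -tE inE => /andP[tC Ft].
have [<- _] := matched_triple_edge (connection_alternating tC) Fv Ft.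
exact: connection_reaches.
Qed.

Lemma connection_arborescence :
  subdigraph D (connection_graph E M Fj) /\ arborescence_with_root D Fj.
Proof.
have tD t : t \in C -> t.1.1 \in nodes D /\ t.2 \in nodes D.
  move=> tC; have c := connection_reaches tC.
  by split; apply: connect_arc_nodes; rewrite ?connect_arc_triple.
have wf : wf_digraph D.
  apply/subsetP=> _ /imsetP[t tC ->]; have [h1 h2] := tD t tC.
  by apply/setXP.
split.
  split=> //; apply/subsetP=> a aD; rewrite inE (subsetP wf) //=.
  by apply: (@arc_alternating_step a.1 a.2); rewrite /arc -surjective_pairing.
apply: rooted_arborescence wf _ connection_nodes_reached.
(* Two arcs into [x] come from triples with the same end, hence from the same triple. *)
- move=> x; apply/card_le1_eqP => _ b /setIdP[/imsetP[t tC ->] /= /eqP tx].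
  case/setIdP=> /imsetP[u uC ->] /= /eqP ux.
  rewrite (@reach_triple_unique t u) ?tx ?ux // -tx.
  by apply: node_reach (triple_end_neq_exposed tC); case: (tD t tC).
- apply/setP=> a; rewrite !inE; apply/negbTE/negP.
  by case/andP=> /imsetP[t tC ->] /=; apply/negP; exact: triple_end_neq_exposed.
- by rewrite !inE eqxx.
Qed.

End Connection.

(** * From an arborescence to a connection *)

Lemma arborescence_connection :
  C != set0 -> subdigraph D (connection_graph E M Fj) ->
  arborescence_with_root D Fj -> connection E M Fj C.
Proof.
move=> /set0Pn[t0 t0C] [wf _ sub] [[[_ _ indeg] conn] root].
have tD t : t \in C -> t.1.1 \in nodes D /\ t.2 \in nodes D.
  by move=> tC; have /setXP := subsetP wf _ (arc_in_arcs tC).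
have alt t : t \in C -> alternating_triple E M t.
  move=> tC; have tM := C_matched tC.
  (* The arc of the connection graph comes with some variable [v]; being matched to the end of the
     triple, it is the variable of the triple. *)
  have := subsetP sub _ (arc_in_arcs tC); rewrite inE => /andP[_].
  case/existsP=> v /andP[/= v1 v2]; case: t tC tM v1 v2 => [[a w] b] _ /= bw.
  by move=> av bv; rewrite (matching_var bw bv); split.
have FjD : Fj \in nodes D by rewrite !inE eqxx.
(* Each arc, in either direction, is replaced by the two edges through the variable of its
   triple. *)
have lift_conn x y :
    connect (underlying_adj D) x y -> connect (edge_adj S) (inl x) (inl y).
  case/connectP=> p; elim: p x => [|z p IH] x /= => [_ ->|]; first exact: connect0.
  case/andP=> /existsP[a /andP[/imsetP[t tC ->] xz]] pz yl.
  apply: connect_trans (IH _ pz yl).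
  have h1 := triple_edges_start tC; have h2 := triple_edges_end tC.
  by case/orP: xz => /eqP[<- <-]; apply: (@connect_trans _ _ (inr t.1.2));
    apply: connect1.
split=> //.
- have toFj x : x \in edge_nodes S -> connect (edge_adj S) x (inl Fj).
    have base F v : (F, v) \in S -> connect (edge_adj S) (inl F) (inl Fj).
      case/triple_edgesP=> t tC [_ FE]; apply: lift_conn; apply: conn => //.
      by have [h1 h2] := tD t tC; case: FE => ->.
    rewrite inE => /existsP[]; case: x => [F|v] [G|w] //= FS; first exact: base FS.
    by apply: connect_trans (base _ _ FS); apply: connect1.
  move=> x y xS yS; apply: connect_trans (toFj x xS) _.
  by rewrite (sym_connect_sym edge_adj_sym); exact: toFj.
- move=> F v FR FM.
  have FD : F \in nodes D by rewrite inE FR orbT.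
  have FFj : F != Fj by apply: contraTneq FM => ->; exact: Fj_exposed.
  (* Only the root has no incoming arc, and [F] is not the root because it is matched. *)
  have [a] : exists a, a \in arcs_into D F.
    apply/set0Pn; apply: contraNneq FFj => F0.
    by rewrite -in_set1 -root inE FD F0 eqxx.
  rewrite inE => /andP[/imsetP[t tC ->] /= /eqP tF].
  have tv : t.1.2 = v by apply: (@matching_var F) => //; rewrite -tF C_matched.
  apply/eqP/cards1P; exists t; apply/setP=> u; rewrite !inE.
  apply/andP/eqP => [[uC uE]|->].
    have [uF uv] := matched_triple_edge (alt u uC) FM uE.
    (* Ends and variables of [t] and [u] agree already; the bound on arcs into [F] makes their
       starts agree. *)
    have := card_le1_eqP (indeg _ FD) (t.1.1, t.2) (u.1.1, u.2).
    rewrite !inE /= tF uF eqxx !andbT -{1}tF -{1}uF.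
    move=> /(_ (arc_in_arcs tC) (arc_in_arcs uC)) [tu].
    case: u t uF uv tu tF tv {tC uC uE} => [[? ?] ?] [[? ?] ?] /=.
    by move=> -> -> -> -> ->.
  by rewrite -tF -tv mem_triple_edges_end.
- have [_ h2] := tD t0 t0C.
  (* The last edge of an undirected walk to [Fj] comes from an arc at [Fj]. No triple ends in the
     exposed node [Fj], so this arc leaves it. *)
  have := conn _ _ h2 FjD => /connect_last_step/(_ (triple_end_neq_exposed t0C)).
  case=> z _ /existsP[a /andP[/imsetP[t tC ->]]].
  case/orP=> /eqP[] e1 e2; last by exists t.
  by have := triple_end_neq_exposed tC; rewrite e2 eqxx.
Qed.

End Triples.
End Matching.

Theorem theorem3p8 (VE VV : finType) (E M : {set VE * VV}) (Fj : VE)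
    (n : nat) (t : 'I_n -> VE * VV * VE) :
  matching E M ->
  exposed M Fj ->
  0 < n ->
  injective t ->
  (forall m, ((t m).2, (t m).1.2) \in M) ->
  connection E M Fj [set t m | m : 'I_n] <->
  (let D := Digraph (nodes (connection_graph E M Fj))
                    [set ((t m).1.1, (t m).2) | m : 'I_n] in
   subdigraph D (connection_graph E M Fj) /\ arborescence_with_root D Fj).
Proof.
move=> ME Fj_exposed n_gt0 _ tM; set C := [set t m | m : 'I_n].
have C_matched u : u \in C -> (u.2, u.1.2) \in M by case/imsetP=> m _ ->.
have -> : [set ((t m).1.1, (t m).2) | m : 'I_n] = [set (u.1.1, u.2) | u in C].
  by rewrite -imset_comp.
split=> [CC|[sub arb]]; first exact: connection_arborescence.
apply: arborescence_connection => //.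
by apply/set0Pn; exists (t (Ordinal n_gt0)); exact: imset_f.
Qed.
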